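(* Let $\mathcal M$ be a von Neumann algebra acting on a finite-dimensional Hilbert space $h$, and let $P=(P_t)_{t\ge0}$ be a continuous, positive, identity-preserving semigroup on $\mathcal M$ with a faithful invariant density $\rho$, symmetric with respect to the scalar product $\langle f,g\rangle=\mathrm{tr}(\rho^{1/2}f^*\rho^{1/2}g)$. Let $c>0$, and suppose that $P$ satisfies the logarithmic Sobolev inequality with constant $c$: $$H(f)\le c\,\mathcal E(f,f)\qquad\text{for all strictly positive } f\in\mathcal M.$$ Then $P$ satisfies the spectral gap inequality with constant $c^{-1}$: $$c^{-1}\,\mathrm{Var}(f)\le\mathcal E(f,f)\qquad\text{for all } f\in\mathcal M.$$
   Context: $\mathrm{tr}$ is the usual trace on operators on $h$. The semigroup $P=(P_t)_{t\ge0}$ consists of linear maps $P_t:\mathcal M\to\mathcal M$ with $P_0=\mathrm{id}$, $P_{t+s}=P_tP_s$, $t\mapsto P_t$ continuous, $P_t(f)\ge0$ whenever $f\ge0$, and $P_t(\mathbf 1)=\mathbf 1$. The faithful invariant density $\rho\in\mathcal M$ is strictly positive (invertible) with $\mathrm{tr}(\rho)=1$ and $\mathrm{tr}(\rho P_tf)=\mathrm{tr}(\rho f)$ for all $t\ge 0$, $f\in\mathcal M$. Symmetry means $\langle P_tf,g\rangle=\langle f,P_tg\rangle$ for all $f,g\in\mathcal M$, $t\ge0$. $\mathcal L$ denotes the infinitesimal generator of $P$, and $$\mathcal E(f,g)=-\langle f,\mathcal Lg\rangle=-\mathrm{tr}(\rho^{1/2}f^*\rho^{1/2}\mathcal Lg).$$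 The $L^2$ norm is $\|f\|_2=\langle f,f\rangle^{1/2}$, and $\mathrm{Var}(f)=\|f-\mathrm{tr}(\rho f)\mathbf 1\|_2^2$. For strictly positive $f\in\mathcal M$ (i.e. $f\ge\varepsilon\mathbf 1$ for some $\varepsilon>0$), define $$T_2(f)=\rho^{-1/4}(\rho^{1/4}f\rho^{1/4})\log(\rho^{1/4}f\rho^{1/4})\rho^{-1/4}-\tfrac14(f\log\rho+\log\rho\, f),$$ $$H(f)=\langle f,T_2(f)\rangle-\|f\|_2^2\log\|f\|_2.$$ $\log$ is the natural logarithm (functional calculus for operators). *)

(* Defs.v *)
From mathcomp Require Import all_boot all_order all_algebra.
From mathcomp Require Import complex.
From mathcomp Require Import all_classical all_reals all_analysis.

Set Implicit Arguments.
Unset Strict Implicit.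
Unset Printing Implicit Defensive.

Import Order.TTheory GRing.Theory Num.Theory.
Import numFieldNormedType.Exports.

Local Open Scope classical_set_scope.
Local Open Scope ring_scope.
Local Open Scope complex_scope.
Local Open Scope sesquilinear_scope.

(* Operators on h = C^n, acting on column vectors. *)
Notation operator R n := 'M[R[i]]_n.

(* The same type with its topology: R[i]^o carries the topology of the modulus,
   which R[i] itself lacks in the library. *)
Notation top_operator R n := 'M[(R[i])^o]_n.

Section Operators.
Context {R : realType} {n : nat}.
Implicit Types A f g : operator R n.

Definition adj A : operator R n := A ^t*.

Definition commutant (S : set (operator R n)) : set (operator R n) :=
  [set A | forall B, S B -> A *m B = B *m A].

Definition von_neumann_algebra (M : set (operator R n)) : Prop :=
  (forall A, M A -> M (adj A)) /\ commutant (commutant M) = M.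

(* On R[i] the relation 0 <= z means that z is real and nonnegative, so this
   forces A to be Hermitian. *)
Definition positive A : Prop :=
  forall v : 'cV[R[i]]_n, 0 <= (v ^t* *m A *m v) 0 0.

Definition strictly_positive A : Prop :=
  exists2 e : R, 0 < e & positive (A - (e%:C)%:M).

(* phi(A) for Hermitian A; the eigenvalues are then real, and Re only casts
   them from R[i] to R. *)
Definition funcalc (phi : R -> R) A : operator R n :=
  invmx (spectralmx A)
  *m diag_mx (map_mx (fun z : R[i] => (phi (complex.Re z))%:C) (spectral_diag A))
  *m spectralmx A.

Definition mxpow A (a : R) : operator R n := funcalc (fun x => x `^ a) A.

Definition mxlog A : operator R n := funcalc (@ln R) A.

End Operators.

Section Semigroup.
Context {R : realType} {n : nat}.
Variables (M : set (operator R n)) (P : R -> operator R n -> operator R n).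
Variable rho : operator R n.
Implicit Types f g : operator R n.

(* Only the values of P t on M, for t >= 0, are constrained. Since M has finite
   dimension, continuity of t |-> P t is continuity of every orbit. *)
Record positive_semigroup : Prop := PositiveSemigroup {
  psg_stable : forall t f, 0 <= t -> M f -> M (P t f);
  psg_linear : forall t (a : R[i]) f g, 0 <= t -> M f -> M g ->
    P t (a *: f + g) = a *: P t f + P t g;
  psg_0 : forall f, M f -> P 0 f = f;
  psg_D : forall s t f, 0 <= s -> 0 <= t -> M f -> P (t + s) f = P t (P s f);
  psg_continuous : forall f, M f ->
    {within `[0, +oo[%classic, continuous (fun t : R => P t f : top_operator R n)};
  psg_positive : forall t f, 0 <= t -> M f -> positive f -> positive (P t f);
  psg_unital : forall t, 0 <= t -> P t 1%:M = 1%:M }.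

Record faithful_invariant_density : Prop := FaithfulInvariantDensity {
  fid_mem : M rho;
  fid_strictly_positive : strictly_positive rho;
  fid_tr : \tr rho = 1;
  fid_invariant : forall t f, 0 <= t -> M f ->
    \tr (rho *m P t f) = \tr (rho *m f) }.

Definition ip f g : R[i] :=
  \tr (mxpow rho (2^-1) *m adj f *m mxpow rho (2^-1) *m g).

Definition symmetric_semigroup : Prop :=
  forall t f g, 0 <= t -> M f -> M g -> ip (P t f) g = ip f (P t g).

Definition norm2 f : R := Num.sqrt (complex.Re (ip f f)).

Definition Var f : R := norm2 (f - (\tr (rho *m f))%:M) ^+ 2.

Definition generator f : operator R n :=
  lim ((fun t : R => (t^-1)%:C *: (P t f - f) : top_operator R n) @ 0^'+).

Definition dirichlet f g : R[i] := - ip f (generator g).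

Definition T2 f : operator R n :=
  let g := mxpow rho (4^-1) *m f *m mxpow rho (4^-1) in
  mxpow rho (- 4^-1) *m (g *m mxlog g) *m mxpow rho (- 4^-1)
  - (4^-1 : R)%:C *: (f *m mxlog rho + mxlog rho *m f).

Definition H f : R[i] :=
  ip f (T2 f) - (norm2 f ^+ 2 * ln (norm2 f))%:C.

(* In the next two definitions <= is the order of R[i]: the imaginary parts are
   equal and the real parts are compared. *)
Definition log_sobolev (c : R) : Prop :=
  forall f, M f -> strictly_positive f -> H f <= c%:C * dirichlet f f.

Definition spectral_gap (lambda : R) : Prop :=
  forall f, M f -> (lambda * Var f)%:C <= dirichlet f f.

End Semigroup.

(* Main.v *)
(* For self-adjoint f put G = rho^(1/4) f rho^(1/4) and D = rho^(1/2); then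
   H(f) = tr G^2 (log G - log D) - (1/2) m log m with m = tr G^2. Linearize at
   f = 1 + t g with tr(rho g) = 0: G_t = D + t k, k = rho^(1/4) g rho^(1/4), and
   H(1 + t g) >= t^2 tr k^2 - O(t^3) = t^2 Var(g) - O(t^3), whereas
   E(1 + t g, 1 + t g) = t^2 E(g, g); let t tend to 0.

   No matrix function is differentiated. Traces of products of functions of two
   self-adjoint matrices are sums over pairs of eigenvalues with nonnegative
   weights, so scalar inequalities pass to traces: convexity (Klein) bounds from
   below the increment of psi(t) = 2 tr G_t^2 (log G_t - log D) - tr G_t^2 + 1 by
   its derivative at the left end point, which (x^2 - y^2)(ln x - ln y) >=
   2 (x - y)^2 and the Lipschitz bound for log estimate by 4 t tr k^2 - O(t^2);
   summing over a fine subdivision of [0, t] gives psi(t) >= 2 t^2 tr k^2 - O(t^3).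

   The limit defining the generator need not be shown to exist beforehand: for
   self-adjoint g <> 0 with tr(rho g) = 0, divergence would make the generator
   at 1 + t g the default value 0, and the logarithmic Sobolev inequality would
   give H(1 + t g) <= 0 for small t. A general f is split as
   tr(rho f) 1 + a + i b. *)
From HB Require Import structures.
Require Import Defs.
From mathcomp Require Import all_boot all_order all_algebra.
From mathcomp Require Import complex.
From mathcomp Require Import all_classical all_reals all_analysis.
From mathcomp Require Import ring lra.

Set Implicit Arguments.
Unset Strict Implicit.
Unset Printing Implicit Defensive.

Import Order.TTheory GRing.Theory Num.Theory.
Import numFieldNormedType.Exports.

Local Open Scope classical_set_scope.
Local Open Scope ring_scope.
Local Open Scope complex_scope.
Local Open Scope sesquilinear_scope.

(** * Scalar inequalities *)

Section Scalar.
Context {R : realType}.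
Implicit Types x y : R.

Lemma lnB_le x y : 0 < x -> 0 < y -> ln x - ln y <= (x - y) / y.
Proof.
move=> x0 y0; rewrite -ln_div ?posrE //.
have -> : x / y = 1 + (x - y) / y by rewrite mulrBl divff ?gt_eqF // addrC subrK.
by apply: le_ln1Dx; rewrite mulrBl divff ?gt_eqF // ltrBrDl subrr divr_gt0.
Qed.

(** Convexity: this is the gap between [u ln u] at [u = x^2] and its tangent at [y^2]. *)
Lemma entropy_tangent x y : 0 < x -> 0 < y ->
  0 <= 2 * (x * x * ln x) - 2 * (x * x * ln y) - x * x + y * y.
Proof.
move=> x0 y0; have := @lnB_le (y * y) (x * x) (mulr_gt0 y0 y0) (mulr_gt0 x0 x0).
rewrite ler_pdivlMr ?mulr_gt0 // !lnM ?posrE //.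
lra.
Qed.

(** Amounts to tanh(x/2) <= x/2. The difference of the two sides vanishes at 0 and has a nonnegative
    derivative. *)
Lemma expR_tanh x : 0 <= x -> 2 * (expR x - 1) <= (expR x + 1) * x.
Proof.
move=> x0; rewrite -subr_ge0.
pose f (t : R) := (expR t + 1) * t - 2 * (expR t - 1).
pose df (t : R) := expR t * t - expR t + 1.
have fd (t : R^o) : is_derive t 1 f (df t).
  rewrite /f; apply: is_derive_eq.
  by rewrite /df /GRing.scale /=; ring.
have := @MVT_segment R f df 0 x x0 (fun t _ => fd t).
case.
  apply: continuous_subspaceT => t.
  by apply/differentiable_continuous/derivable1_diffP; case: (fd t).
move=> c cx; rewrite /f expR0 subrr !mulr0 !subr0 => ->.
apply: mulr_ge0 => //; rewrite /df.
(* After division by [expR c] the claim is [expR (- c) >= 1 - c]. *)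
have := expR_ge1Dx (- c); rewrite expRN -(ler_pM2l (expR_gt0 c)) divff ?gt_eqF ?expR_gt0 //.
lra.
Qed.

(** The logarithmic mean is at most the arithmetic mean, which is [expR_tanh] at [ln x - ln y]; a
    further factor [x - y] makes both sides symmetric in x and y. *)
Lemma log_mean x y : 0 < x -> 0 < y ->
  2 * ((x - y) * (x - y)) <= (x * x - y * y) * (ln x - ln y).
Proof.
wlog yx : x y / y <= x => [H x0 y0|x0 y0].
  have [/H|/ltW/H] := leP y x; first exact.
  by move=> /(_ y0 x0); lra.
have l0 : 0 <= ln x - ln y by rewrite subr_ge0 ler_ln ?posrE.
have := expR_tanh l0; rewrite expRD expRN !lnK ?posrE // => h.
have {}h : 2 * (x - y) <= (x + y) * (ln x - ln y).
  have := ler_wpM2r (ltW y0) h; have := mulfVK (lt0r_neq0 y0) x.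
  by move: (x / y) (ln x - ln y) => q l qy; rewrite -qy; lra.
have : 0 <= x - y by rewrite subr_ge0.
by move=> /ler_wpM2l/(_ _ _ h); lra.
Qed.

(** Squared, because the trace of a squared difference is what expands over pairs of eigenvalues. *)
Lemma ln_lipschitz (e : R) x y : 0 < e -> e <= x -> e <= y ->
  (ln x - ln y) * (ln x - ln y) <= (e * e)^-1 * ((x - y) * (x - y)).
Proof.
move=> e0.
wlog yx : x y / y <= x => [H ex ey|ex ey].
  have [/H|/ltW/H] := leP y x; first exact.
  by move=> /(_ ey ex); lra.
have y0 : 0 < y by exact: lt_le_trans ey.
have x0 : 0 < x by exact: lt_le_trans ex.
have l0 : 0 <= ln x - ln y by rewrite subr_ge0 ler_ln ?posrE.
have h : ln x - ln y <= e^-1 * (x - y).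
  apply: le_trans (lnB_le x0 y0) _; rewrite mulrC ler_wpM2r ?subr_ge0 //.
  by rewrite lef_pV2 ?posrE.
by rewrite invfM mulrACA; apply: ler_pM.
Qed.

Lemma ln_sqrt x : 0 < x -> ln (Num.sqrt x) = ln x / 2.
Proof.
move=> x0; rewrite -[in RHS](sqr_sqrtr (ltW x0)) lnXn ?sqrtr_gt0 //.
by rewrite -[X in _ = X / _]mulr_natr mulfK.
Qed.

(* The real-number content of [entropy_step]: [u] and [v] are the traces of
   [(D k + k D) X] and [k^2 X] with [X = log G_s - log D]. *)
Lemma entropy_step_arith (s t K I k4 et mt lt es ls nt ns xt xs d u v g xx : R) :
  0 < s -> s <= t ->
  0 <= 2 * et - 2 * mt - nt + ns -> 2 * g <= xs - d -> xx <= I * g ->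
  g = s * s * K -> 0 <= xx + 2 * s * v + s * s * k4 ->
  xt = mt - lt -> xs = es - ls ->
  xt = d + t * u + t * t * v -> xs = d + s * u + s * s * v ->
  4 * (t - s) * s * K - (t - s) * t * s * (I * K + k4) <=
  (2 * et - 2 * lt - nt + 1) - (2 * es - 2 * ls - ns + 1).
Proof.
move=> s0 st kl lm lip gE hv xtE xsE xt' xs'.
have su : 2 * s * K - s * v <= u.
  by rewrite -(ler_pM2l s0); rewrite gE in lm; lra.
have sv : - (s * (I * K + k4)) <= 2 * v.
  by rewrite -(ler_pM2l s0); rewrite gE in lip; lra.
have ts : 0 <= t - s by rewrite subr_ge0.
(* By [kl] the increment is at least [2 (xt - xs) = 2 (t - s) (u + (t + s) v)]. The bound [su]
   reduces the last factor to [2 s K + t v], and [sv] controls [t v]. *)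
have h1 := ler_wpM2l ts su.
have h2 := ler_wpM2l (mulr_ge0 ts (le_trans (ltW s0) st)) sv.
lra.
Qed.

(** The step bounds over an equidistant subdivision add up to a Riemann sum of [4 s K], whose
    integral over [0, t] is [2 t^2 K]; the errors add up to at most [t^3 C]. *)
Lemma entropy_telescope (psi : R -> R) (K C t0 : R) : 0 <= C ->
  (forall t : R, 0 < t <= t0 -> 0 <= psi t) ->
  (forall s t : R, 0 < s -> s <= t <= t0 ->
     4 * (t - s) * s * K - (t - s) * t * s * C <= psi t - psi s) ->
  forall t : R, 0 < t <= t0 -> 2 * t * t * K - t * t * t * C <= psi t.
Proof.
move=> C0 psi0 step t /andP[tp tt0].
(* The sum of [4 h (i h)] for i from 1 to j is [2 h^2 j (j + 1)]. The induction starts at [h], where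
   [psi0] suffices, since a step must start at a positive point. *)
have key (N : nat) (h : R) : 0 < h -> N.+1%:R * h = t ->
    forall j, (j <= N)%N ->
    2 * h * h * (j.+1%:R * j%:R) * K - j%:R * h * t * t * C <= psi (j.+1%:R * h).
  move=> h0 Nh; elim=> [_|j IH jN].
    rewrite mulr0 !mul0r subr0 mulr0 mul0r mul1r.
    have ht : h <= t by rewrite -Nh -[leLHS]mul1r ler_pM2r // ler1n.
    by apply: psi0; rewrite h0 (le_trans ht).
  have jt : j.+2%:R * h <= t by rewrite -Nh ler_pM2r // ler_nat.
  have j0 : 0 < j.+1%:R * h by rewrite mulr_gt0.
  have jj : j.+1%:R * h <= j.+2%:R * h by rewrite ler_pM2r // ler_nat.
  have := step _ _ j0; move/(_ (j.+2%:R * h)); rewrite jj (le_trans jt tt0) => /(_ isT).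
  have := IH (ltnW jN).
  have : j.+2%:R * h * (j.+1%:R * h) * (h * C) <= t * t * (h * C).
    apply: ler_wpM2r; first by rewrite mulr_ge0 // ltW.
    by apply: ler_pM => //; rewrite ?(ltW j0) ?(le_trans jj) // (le_trans (ltW j0)).
  rewrite -[j.+2]addn1 -[j.+1]addn1 !natrD.
  move: (psi _) (psi _) => p q; move: (j%:R : R) => x; lra.
apply/ler_addgt0Pr => eps eps0.
(* The Riemann sum differs from [2 t^2 K] by [2 t h K]; more than [x] subintervals bring this down
   to [eps] in absolute value. *)
set x := 2 * t * t * `|K| / eps.
have x0 : 0 <= x by rewrite divr_ge0 ?mulr_ge0 // ltW.
set N := Num.bound x.
have Nx : x < N.+1%:R by rewrite (lt_trans (archi_boundP x0)) // ltr_nat.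
have N0 : 0 < N.+1%:R :> R by [].
set h := t / N.+1%:R.
have h0 : 0 < h by rewrite divr_gt0.
have Nh : N.+1%:R * h = t by rewrite mulrC divfK // gt_eqF.
have := key N h h0 Nh N (leqnn N).
have Nh' : N%:R * h = t - h by rewrite -Nh -natr1 mulrDl mul1r addrK.
have hK : 2 * t * h * `|K| <= eps.
  rewrite /h mulrA -mulrA (mulrC _^-1) mulrA ler_pdivrMr //.
  by rewrite -ler_pdivrMl // mulrC ltW.
have K1 : K * (2 * t * h) <= `|K| * (2 * t * h).
  by apply: ler_wpM2r (ler_norm K); rewrite !mulr_ge0 // ltW.
have hC : 0 <= h * (t * t * C) by rewrite !mulr_ge0 // ltW.
have -> : 2 * h * h * (N.+1%:R * N%:R) * K = 2 * (N.+1%:R * h) * (N%:R * h) * K.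
  by ring.
rewrite Nh Nh'.
lra.
Qed.

(** With m = 1 + t^2 K, [ln m <= t^2 K] bounds the norm term by [m t^2 K / 2]; its quartic part
    joins the cubic error because [t <= 1]. *)
Lemma entropy_bound_arith (t K C a b : R) : 0 < t -> t <= 1 -> 0 <= K ->
  2 * t * t * K - t * t * t * C <= 2 * a - 2 * b - (1 + t * t * K) + 1 ->
  t * t * K - t * t * t * ((C + K * K) / 2) <=
  a - b - (1 + t * t * K) * ln (1 + t * t * K) / 2.
Proof.
move=> tp t1 K0 h0.
have ttK : 0 <= t * t * K by rewrite !mulr_ge0 // ltW.
have m0 : 0 < 1 + t * t * K by rewrite ltr_pwDl.
have lnm : ln (1 + t * t * K) <= t * t * K by apply: le_ln1Dx; lra.
have h1 : (1 + t * t * K) * ln (1 + t * t * K) <= (1 + t * t * K) * (t * t * K).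
  by rewrite ler_pM2l.
have h2 : t * (t * t * t * (K * K)) <= 1 * (t * t * t * (K * K)).
  by apply: ler_wpM2r => //; rewrite !mulr_ge0 // ltW.
lra.
Qed.

End Scalar.

(** * Functional calculus and traces *)

(* Locked: unification otherwise unfolds matrix products and diverges. *)
HB.lock Definition uconj {R : realType} {n : nat} (V : operator R n)
    (a : 'I_n -> R) : operator R n :=
  V ^t* *m diag_mx (\row_i (a i)%:C) *m V.

Section FunctionalCalculus.
Context {R : realType} {n : nat}.
Implicit Types (A B V W : operator R n) (a b : 'I_n -> R).

Definition selfadjoint A := adj A = A.

Lemma uconjE V a : uconj V a = V ^t* *m diag_mx (\row_i (a i)%:C) *m V.
Proof. by rewrite unlock. Qed.

Lemma eq_diag_conj V (d d' : 'rV[R[i]]_n) : (forall i, d 0 i = d' 0 i) ->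
  V ^t* *m diag_mx d *m V = V ^t* *m diag_mx d' *m V.
Proof. by move=> /rowP ->. Qed.

Lemma conjC_real (x : R) : (x%:C)^*%R = x%:C :> R[i].
Proof. exact: conjc_real. Qed.

Lemma conjC_i : ('i : R[i])^*%R = - 'i.
Proof. by apply/eqP; rewrite eq_complex /= oppr0 !eqxx. Qed.

Lemma adj_mulmx A B : adj (A *m B) = adj B *m adj A.
Proof. by rewrite /adj trmx_mul map_mxM. Qed.

Lemma adj_add A B : adj (A + B) = adj A + adj B.
Proof. by rewrite /adj linearD /= map_mxD. Qed.

Lemma adj_opp A : adj (- A) = - adj A.
Proof. by rewrite /adj linearN /= map_mxN. Qed.

Lemma adj_scale (c : R[i]) A : adj (c *: A) = c^*%R *: adj A.
Proof. by rewrite /adj linearZ /= map_mxZ. Qed.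

Lemma adj_adj A : adj (adj A) = A.
Proof. exact: trmxCK. Qed.

Lemma adj_scalar (c : R[i]) : adj (c%:M : operator R n) = (c^*%R)%:M.
Proof. by rewrite /adj tr_scalar_mx map_scalar_mx. Qed.

Lemma mxtr_adj A : \tr (adj A) = (\tr A)^*%R.
Proof. by rewrite /adj /mxtrace rmorph_sum; apply: eq_bigr => i _; rewrite !mxE. Qed.

Lemma adj_uconj V a : selfadjoint (uconj V a).
Proof.
rewrite /selfadjoint uconjE !adj_mulmx /adj trmxCK -!mulmxA; congr (_ *m (_ *m _)).
by apply/matrixP => i j; rewrite !mxE rmorphMn /= conjC_real eq_sym; case: eqP => [->|].
Qed.

Lemma unitarymxC V : V \is unitarymx -> V ^t* *m V = 1%:M.
Proof. by move=> Vu; rewrite -(mul1mx (V ^t*)) mulmxKtV. Qed.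

Lemma uconjM V a b : V \is unitarymx ->
  uconj V a *m uconj V b = uconj V (fun i => a i * b i).
Proof.
move=> /unitarymxP Vu; rewrite !uconjE -!mulmxA (mulmxA V) Vu mul1mx.
rewrite (mulmxA (diag_mx _)) mulmx_diag; congr (_ *m (diag_mx _ *m _)).
by apply/rowP => i; rewrite !mxE rmorphM.
Qed.

Lemma uconj_cst V (c : R) : V \is unitarymx -> uconj V (fun=> c) = (c%:C)%:M.
Proof.
move=> Vu; rewrite uconjE.
have -> : \row_(i < n) c%:C = const_mx c%:C by apply/rowP => i; rewrite !mxE.
by rewrite diag_const_mx mul_mx_scalar -scalemxAl unitarymxC // scalemx1.
Qed.

Lemma uconjD V a b : uconj V a + uconj V b = uconj V (fun i => a i + b i).
Proof.
rewrite !uconjE -mulmxDl -mulmxDr -linearD /=.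
by apply: eq_diag_conj => i; rewrite !mxE rmorphD.
Qed.

Lemma uconjZ V (c : R) a : c%:C *: uconj V a = uconj V (fun i => c * a i).
Proof.
rewrite !uconjE scalemxAl scalemxAr -linearZ /=.
by apply: eq_diag_conj => i; rewrite !mxE rmorphM.
Qed.

Lemma uconjB_cst V a (e : R) : V \is unitarymx ->
  uconj V a - (e%:C)%:M = uconj V (fun i => a i - e).
Proof.
move=> Vu; rewrite -(uconj_cst e Vu) -scaleN1r.
have -> : -1 = (-1 : R)%:C :> R[i] by rewrite rmorphN1.
by rewrite uconjZ uconjD; congr uconj; apply/funext => i; rewrite mulN1r.
Qed.

Lemma quad_uconj V a (v : 'cV[R[i]]_n) :
  (v ^t* *m uconj V a *m v) 0 0 = \sum_i (a i)%:C * `|(V *m v) i 0| ^+ 2.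
Proof.
rewrite uconjE !mulmxA -map_mxM -trmx_mul -mulmxA mul_mx_diag mxE.
apply: eq_bigr => i _; rewrite !mxE normCK.
rewrite -!mulrA mulrCA; congr (_ * _); rewrite mulrC.
by congr (_ * _); rewrite !mxE.
Qed.

Lemma positive_uconj V a : V \is unitarymx ->
  positive (uconj V a) <-> forall i, 0 <= a i.
Proof.
move=> Vu; split=> [Hp i|Ha v].
  have := Hp (V ^t* *m delta_mx i 0).
  rewrite quad_uconj mulmxA (unitarymxP Vu) mul1mx (bigD1 i) //= big1 ?addr0.
    by rewrite !mxE !eqxx normr1 expr1n mulr1 ler0c.
  by move=> j ji; rewrite !mxE (negbTE ji) normr0 expr0n mulr0.
rewrite quad_uconj; apply: sumr_ge0 => i _; rewrite mulr_ge0 ?exprn_ge0 //.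
by rewrite ler0c.
Qed.

(** One diagonalization serves A and all its functions, so that statements about [funcalc] become
    statements about families of eigenvalues. *)
Lemma uconj_spectral A : selfadjoint A -> exists V a,
  [/\ V \is unitarymx, A = uconj V a &
      forall phi, funcalc phi A = uconj V (phi \o a)].
Proof.
move=> hA; have Ah : A \is hermsymmx.
  by rewrite is_hermitianmxE expr0 scale1r; apply/eqP; rewrite -[LHS]hA.
have /mxOverP dr := hermitian_spectral_diag_real Ah.
exists (spectralmx A), (fun i => complex.Re (spectral_diag A 0 i)).
have Vu := spectral_unitarymx A.
split=> //; last first.
  move=> phi; rewrite /funcalc uconjE (invmx_unitary Vu).
  by apply: eq_diag_conj => i; rewrite !mxE.
have /orthomx_spectralP AE := hermitian_normalmx Ah.
rewrite [LHS]AE uconjE (invmx_unitary Vu).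
by apply: eq_diag_conj => i; rewrite !mxE RRe_real.
Qed.

(* |<v_i, w_j>|^2 for the orthonormal bases formed by the rows of V and W. *)
Definition overlap V W (i j : 'I_n) : R :=
  complex.Re ((V *m W ^t*) i j) ^+ 2 + complex.Im ((V *m W ^t*) i j) ^+ 2.

Lemma overlap_ge0 V W i j : 0 <= overlap V W i j.
Proof. by rewrite addr_ge0 ?sqr_ge0. Qed.

(** Inequalities are proved in R, between real parts; [retr_mul_real] recovers the traces
    themselves. *)
Definition retr A : R := complex.Re (\tr A).

Lemma retrD A B : retr (A + B) = retr A + retr B.
Proof. by rewrite /retr mxtraceD; case: (\tr A) (\tr B) => ? ? []. Qed.

Lemma retrN A : retr (- A) = - retr A.
Proof. by rewrite /retr linearN /=; case: (\tr A). Qed.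

Lemma retrB A B : retr (A - B) = retr A - retr B.
Proof. by rewrite retrD retrN. Qed.

Lemma retrZ (c : R) A : retr (c%:C *: A) = c * retr A.
Proof. by rewrite /retr mxtraceZ; case: (\tr A) => ? ? /=; rewrite mul0r subr0. Qed.

Lemma retrC A B : retr (A *m B) = retr (B *m A).
Proof. by rewrite /retr mxtrace_mulC. Qed.

(** With X = V W*, cyclicity turns the trace into the sum of [a i * X i j * b j] times the conjugate
    of [X i j]. *)
Lemma trace_uconjM V W a b :
  \tr (uconj V a *m uconj W b) =
  (\sum_i \sum_j overlap V W i j * (a i * b j))%:C.
Proof.
rewrite !uconjE -!mulmxA mxtrace_mulC -!mulmxA mulmxA.
set X := V *m W ^t*.
have -> : W *m V ^t* = X ^t* by rewrite /X trmx_mul map_mxM -map_trmx trmxCK.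
rewrite -mulmxA (mulmxA V) /overlap -/X; move: X => X.
rewrite /mxtrace rmorph_sum; apply: eq_bigr => i _ /=.
rewrite mul_diag_mx !mxE rmorph_sum mulr_sumr; apply: eq_bigr => j _ /=.
rewrite mul_diag_mx !mxE !rmorphM /= add_Re2_Im2 normCK /=.
ring.
Qed.

Definition overlap_sum V W (F : 'I_n -> 'I_n -> R) : R :=
  \sum_i \sum_j overlap V W i j * F i j.

Lemma overlap_sumD V W F G :
  overlap_sum V W F + overlap_sum V W G = overlap_sum V W (fun i j => F i j + G i j).
Proof.
rewrite /overlap_sum -big_split /=; apply: eq_bigr => i _.
by rewrite -big_split /=; apply: eq_bigr => j _; rewrite mulrDr.
Qed.

Lemma overlap_sumZ V W c F :
  c * overlap_sum V W F = overlap_sum V W (fun i j => c * F i j).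
Proof.
rewrite /overlap_sum mulr_sumr; apply: eq_bigr => i _.
by rewrite mulr_sumr; apply: eq_bigr => j _; rewrite mulrCA.
Qed.

Lemma overlap_sumN V W F :
  - overlap_sum V W F = overlap_sum V W (fun i j => - F i j).
Proof.
by rewrite -mulN1r overlap_sumZ; congr overlap_sum; apply/funext => i;
  apply/funext => j; rewrite mulN1r.
Qed.

Lemma overlap_sum_ge0 V W F : (forall i j, 0 <= F i j) -> 0 <= overlap_sum V W F.
Proof.
by move=> F0; apply: sumr_ge0 => i _; apply: sumr_ge0 => j _; rewrite mulr_ge0 ?overlap_ge0.
Qed.

Lemma retr_uconjM V W a b :
  retr (uconj V a *m uconj W b) = overlap_sum V W (fun i j => a i * b j).
Proof. by rewrite /retr trace_uconjM. Qed.

(** Writing the identity as a constant function in the basis W brings the trace of a single matrix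
    to the same double sum as the mixed traces. *)
Lemma retr_uconjl V W a : W \is unitarymx ->
  retr (uconj V a) = overlap_sum V W (fun i j => a i).
Proof.
move=> Wu; rewrite -[uconj V a]mulmx1 -(uconj_cst 1 Wu) retr_uconjM.
by congr overlap_sum; apply/funext => i; apply/funext => j; rewrite mulr1.
Qed.

Lemma retr_uconjr V W b : V \is unitarymx ->
  retr (uconj W b) = overlap_sum V W (fun i j => b j).
Proof.
move=> Vu; rewrite -[uconj W b]mul1mx -(uconj_cst 1 Vu) retr_uconjM.
by congr overlap_sum; apply/funext => i; apply/funext => j; rewrite mul1r.
Qed.

Lemma positive_selfadjoint A : positive A -> selfadjoint A.
Proof.
move=> pA; pose S := 'i *: (A - adj A).
have hS : selfadjoint S.
  by rewrite /selfadjoint adj_scale conjC_i adj_add adj_opp adj_adj scaleNr -scalerN opprB.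
have qS (v : 'cV[R[i]]_n) : (v ^t* *m S *m v) 0 0 = 0.
  have -> : v ^t* *m S *m v = 'i *: (v ^t* *m A *m v - (v ^t* *m A *m v) ^t*).
    rewrite /S -scalemxAr -scalemxAl mulmxBr mulmxBl.
    by rewrite !trmx_mul !map_mxM trmxCK mulmxA.
  move: (v ^t* *m A *m v) (pA v) => q q0.
  by rewrite !mxE (CrealP (ger0_real q0)) subrr mulr0.
have [V [a [Vu SE _]]] := uconj_spectral hS.
have a0 i : a i = 0.
  apply/eqP; rewrite eq_le; apply/andP; split; last first.
    by move: i; apply/(positive_uconj _ Vu) => v; rewrite -SE qS.
  rewrite -oppr_ge0 -mulN1r.
  rewrite -[X in 0 <= X]/((fun i => -1 * a i) i); move: i; apply/(positive_uconj _ Vu) => v.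
  by rewrite -uconjZ -SE -scalemxAr -scalemxAl mxE qS mulr0.
have S0 : S = 0.
  by rewrite SE (_ : a = fun=> 0) ?uconj_cst // ?raddf0 //; apply/funext.
move/eqP: S0; rewrite scaler_eq0 => /orP[|].
  by rewrite eq_complex /= oner_eq0 andbF.
by rewrite subr_eq0 /selfadjoint => /eqP {2}->.
Qed.

Lemma positiveD A B : positive A -> positive B -> positive (A + B).
Proof. by move=> pA pB v; rewrite mulmxDr mulmxDl mxE addr_ge0. Qed.

Lemma positive_scalar (c : R) : 0 <= c -> positive ((c%:C)%:M : operator R n).
Proof.
move=> c0; have u1 : (1%:M : operator R n) \is unitarymx.
  by apply/unitarymxP; rewrite mul1mx tr_scalar_mx map_scalar_mx rmorph1.
by rewrite -(uconj_cst c u1); apply/positive_uconj.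
Qed.

Lemma selfadjoint_scalar (c : R) : selfadjoint ((c%:C)%:M : operator R n).
Proof. by rewrite /selfadjoint adj_scalar conjC_real. Qed.

Lemma selfadjointD A B : selfadjoint A -> selfadjoint B -> selfadjoint (A + B).
Proof. by rewrite /selfadjoint adj_add => -> ->. Qed.

Lemma selfadjointZ (c : R) A : selfadjoint A -> selfadjoint (c%:C *: A).
Proof. by rewrite /selfadjoint adj_scale conjC_real => ->. Qed.

Lemma selfadjointB A B : selfadjoint A -> selfadjoint B -> selfadjoint (A - B).
Proof. by rewrite /selfadjoint adj_add adj_opp => -> ->. Qed.

Lemma selfadjoint_lower_bound A : selfadjoint A -> exists2 c : R, 0 <= c &
  forall t : R, 0 <= t -> positive (t%:C *: A + ((t * c)%:C)%:M).
Proof.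
(* The sum of the absolute values dominates each eigenvalue. *)
move=> /uconj_spectral[V [a [Vu -> _]]]; exists (\sum_i `|a i|).
  exact: sumr_ge0.
move=> t t0; rewrite uconjZ -(uconj_cst _ Vu) uconjD.
apply/positive_uconj => // i; rewrite -mulrDr mulr_ge0 //.
rewrite (bigD1 i) //= addrA addr_ge0 ?sumr_ge0 //.
by rewrite -lerBlDl sub0r -normrN ler_norm.
Qed.

Lemma spectral_lower_bound (e : R) A : positive (A - (e%:C)%:M) -> exists V a,
  [/\ V \is unitarymx, A = uconj V a, forall i, e <= a i &
      forall phi, funcalc phi A = uconj V (phi \o a)].
Proof.
move=> pA; have hA : selfadjoint A.
  rewrite -(subrK (e%:C)%:M A).
  by apply: selfadjointD; [exact: positive_selfadjoint | exact: selfadjoint_scalar].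
have [V [a [Vu AE ph]]] := uconj_spectral hA.
exists V, a; split => // i; rewrite -subr_ge0.
move: pA; rewrite AE uconjB_cst // => /(positive_uconj _ Vu); exact.
Qed.

Lemma retr_sqr_ge0 A : selfadjoint A -> 0 <= retr (A *m A).
Proof.
move=> /uconj_spectral[V [a [Vu -> _]]].
by rewrite uconjM // (retr_uconjl _ _ Vu); apply: overlap_sum_ge0 => i j; rewrite -expr2 sqr_ge0.
Qed.

Lemma selfadjoint_mxlog (e : R) A : positive (A - (e%:C)%:M) -> selfadjoint (mxlog A).
Proof.
move=> /spectral_lower_bound[V [a [_ _ _ ph]]].
by rewrite /mxlog ph; exact: adj_uconj.
Qed.

End FunctionalCalculus.

(** * Relative entropy near the base point *)

Section RelativeEntropy.
Context {R : realType} {n : nat}.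
Implicit Types (A B V W : operator R n) (a b : 'I_n -> R).

(** Klein's inequality for [u ln u] at A^2 and B^2: each summand of the double sum is
    [entropy_tangent] at a pair of eigenvalues. *)
Lemma klein (e : R) A B : 0 < e ->
  positive (A - (e%:C)%:M) -> positive (B - (e%:C)%:M) ->
  0 <= 2 * retr (A *m A *m mxlog A) - 2 * retr (A *m A *m mxlog B)
       - retr (A *m A) + retr (B *m B).
Proof.
move=> e0 /spectral_lower_bound[V [a [Vu -> ae phA]]].
move=> /spectral_lower_bound[W [b [Wu -> be phB]]].
rewrite /mxlog phA phB !(uconjM _ _ Vu).
rewrite !(uconjM _ _ Wu) (retr_uconjr W _ Vu) !(retr_uconjl V _ Wu) retr_uconjM.
rewrite !overlap_sumZ !overlap_sumN !overlap_sumD.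
apply: overlap_sum_ge0 => i j /=; apply: entropy_tangent.
  exact: lt_le_trans (ae i).
exact: lt_le_trans (be j).
Qed.

(** Every trace here pairs a function of A with a function of B, so [log_mean] can be summed over
    pairs of eigenvalues. *)
Lemma retr_log_mean (e : R) A B : 0 < e ->
  positive (A - (e%:C)%:M) -> positive (B - (e%:C)%:M) ->
  2 * retr ((A - B) *m (A - B)) <=
  retr (A *m A *m (mxlog A - mxlog B)) - retr (B *m B *m (mxlog A - mxlog B)).
Proof.
move=> e0 /spectral_lower_bound[V [a [Vu -> ae phA]]].
move=> /spectral_lower_bound[W [b [Wu -> be phB]]].
rewrite /mxlog phA phB.
rewrite !(mulmxBl, mulmxBr) !(uconjM _ _ Vu) !(uconjM _ _ Wu) !retrB.
rewrite (retrC (uconj W _)) (retrC (uconj W _)).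
rewrite !(retr_uconjr W _ Vu) !(retr_uconjl V _ Wu) !retr_uconjM.
rewrite -subr_ge0 !(overlap_sumN, overlap_sumD, overlap_sumZ).
apply: overlap_sum_ge0 => i j /=.
have := log_mean (lt_le_trans e0 (ae i)) (lt_le_trans e0 (be j)).
lra.
Qed.

(** In the Hilbert-Schmidt norm the logarithm of matrices inherits the scalar Lipschitz constant,
    again pair by pair. *)
Lemma retr_ln_lipschitz (e : R) A B : 0 < e ->
  positive (A - (e%:C)%:M) -> positive (B - (e%:C)%:M) ->
  retr ((mxlog A - mxlog B) *m (mxlog A - mxlog B)) <=
  (e * e)^-1 * retr ((A - B) *m (A - B)).
Proof.
move=> e0 /spectral_lower_bound[V [a [Vu -> ae phA]]].
move=> /spectral_lower_bound[W [b [Wu -> be phB]]].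
rewrite /mxlog phA phB.
rewrite !(mulmxBl, mulmxBr) !(uconjM _ _ Vu) !(uconjM _ _ Wu) !retrB.
rewrite !(retrC (uconj W _) (uconj V _)).
rewrite !(retr_uconjr W _ Vu) !(retr_uconjl V _ Wu) !retr_uconjM.
rewrite -subr_ge0 !(overlap_sumN, overlap_sumD, overlap_sumZ).
apply: overlap_sum_ge0 => i j /=.
have := ln_lipschitz e0 (ae i) (be j).
lra.
Qed.

Lemma real_scalarD (x y : R) :
  ((x + y)%:C)%:M = (x%:C)%:M + (y%:C)%:M :> operator R n.
Proof. by rewrite rmorphD raddfD. Qed.

Lemma real_scalarN (x : R) : ((- x)%:C)%:M = - (x%:C)%:M :> operator R n.
Proof. by rewrite rmorphN raddfN. Qed.

(* When tr D^2 = 1, this is the relative entropy of G^2 with respect to D^2,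
   corrected by 1 - tr G^2. *)
Definition entropy (D G : operator R n) : R :=
  2 * retr (G *m G *m mxlog G) - 2 * retr (G *m G *m mxlog D) - retr (G *m G) + 1.

Lemma sqr_perturbation (D k : operator R n) (t : R) :
  (D + t%:C *: k) *m (D + t%:C *: k) =
  D *m D + t%:C *: (D *m k + k *m D) + (t * t)%:C *: (k *m k).
Proof.
by rewrite mulmxDl !mulmxDr -!scalemxAl -!scalemxAr scalerA -rmorphM scalerDr !addrA.
Qed.

Lemma retr_sqr_perturbation (D k : operator R n) (t : R) :
  retr ((D + t%:C *: k) *m (D + t%:C *: k)) =
  retr (D *m D) + 2 * t * retr (D *m k) + t * t * retr (k *m k).
Proof.
rewrite sqr_perturbation !retrD !retrZ retrD (retrC k).
by move: (retr _) (retr _) (retr _) => x y z; ring.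
Qed.

Lemma retr_sqr_perturbationM (D k X : operator R n) (t : R) :
  retr ((D + t%:C *: k) *m (D + t%:C *: k) *m X) =
  retr (D *m D *m X) + t * retr ((D *m k + k *m D) *m X)
  + t * t * retr (k *m k *m X).
Proof. by rewrite sqr_perturbation !mulmxDl -!scalemxAl !retrD !retrZ mulmxDl retrD. Qed.

Lemma retr_mulmxB A X Y : retr (A *m (X - Y)) = retr (A *m X) - retr (A *m Y).
Proof. by rewrite mulmxBr retrB. Qed.

(** * The entropy along the segment D + t k *)

Section Perturbation.
Variables (D k : operator R n) (e : R).
Hypotheses (e0 : 0 < e) (De : positive (D - ((2 * e)%:C)%:M)) (hk : selfadjoint k).
Hypotheses (D1 : retr (D *m D) = 1) (Dk0 : retr (D *m k) = 0).

Let G (t : R) := D + t%:C *: k.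
Let K := retr (k *m k).
Let C1 := (e * e)^-1 * K + retr (k *m k *m (k *m k)).

Lemma positive_base : positive (D - (e%:C)%:M).
Proof.
have -> : D - (e%:C)%:M = D - ((2 * e)%:C)%:M + (e%:C)%:M.
  rewrite -addrA; congr (D + _); rewrite -!real_scalarN -real_scalarD.
  by congr (_%:C)%:M; ring.
exact: positiveD De (positive_scalar (ltW e0)).
Qed.

Lemma positive_perturbation : exists2 t0 : R, 0 < t0 &
  forall t, 0 <= t <= t0 -> positive (G t - (e%:C)%:M).
Proof.
have [c c0 kc] := selfadjoint_lower_bound hk.
have c1 : 0 < c + 1 by exact: ltr_wpDl.
(* Up to this time [t k] lowers the spectrum by at most [e], half of the margin [2 e] of D; [c + 1]
   keeps the denominator positive. *)
exists (e / (c + 1)); first by rewrite divr_gt0.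
move=> t /andP[t0]; rewrite (ler_pdivlMr _ _ c1) => tc.
have etc : 0 <= e - t * c by lra.
have -> : G t - (e%:C)%:M = D - ((2 * e)%:C)%:M + (t%:C *: k + ((t * c)%:C)%:M)
    + ((e - t * c)%:C)%:M.
  rewrite /G -!addrA; congr (D + _); rewrite [RHS]addrCA; congr (_ + _).
  rewrite -!real_scalarN -!real_scalarD.
  by congr (_%:C)%:M; ring.
exact: positiveD (positiveD De (kc _ t0)) (positive_scalar etc).
Qed.

Lemma retr_base_sqr_perturbation t : retr (G t *m G t) = 1 + t * t * K.
Proof. by rewrite /G retr_sqr_perturbation D1 Dk0 mulr0 addr0. Qed.

(** [klein] at the pair [G t], [G s] bounds the increment below by [2 tr (G_t^2 - G_s^2) X], X = log
    G_s - log D, a polynomial in s and t once X is fixed. *)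
Lemma entropy_step s t : 0 < s -> s <= t ->
  positive (G s - (e%:C)%:M) -> positive (G t - (e%:C)%:M) ->
  4 * (t - s) * s * K - (t - s) * t * s * C1 <= entropy D (G t) - entropy D (G s).
Proof.
move=> s0 st ps pt.
have De' := positive_base.
have GsD : retr ((G s - D) *m (G s - D)) = s * s * K.
  by rewrite /G addrC addKr -scalemxAl -scalemxAr scalerA -rmorphM retrZ.
have kk : selfadjoint (k *m k) by rewrite /selfadjoint adj_mulmx (hk : adj k = k).
pose X := mxlog (G s) - mxlog D.
have hX : selfadjoint X.
  exact: selfadjointB (selfadjoint_mxlog ps) (selfadjoint_mxlog De').
(* Expanding tr (X + s k^2)^2 >= 0 bounds tr k^2 X from below; the Lipschitz bound makes tr X^2 of
   order s^2. *)
have hv := retr_sqr_ge0 (selfadjointD hX (selfadjointZ s kk)).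
rewrite retr_sqr_perturbation (retrC X (k *m k)) in hv.
exact: (entropy_step_arith s0 st (klein e0 pt ps) (retr_log_mean e0 ps De')
  (retr_ln_lipschitz e0 ps De') GsD hv
  (retr_mulmxB (G t *m G t) (mxlog (G s)) (mxlog D))
  (retr_mulmxB (G s *m G s) (mxlog (G s)) (mxlog D))
  (retr_sqr_perturbationM D k X t) (retr_sqr_perturbationM D k X s)).
Qed.

Lemma entropy_lower_bound : exists2 t0 : R, 0 < t0 &
  forall t, 0 < t <= t0 -> positive (G t - (e%:C)%:M) /\
    2 * t * t * K - t * t * t * C1 <= entropy D (G t).
Proof.
have [t0 t00 pG] := positive_perturbation.
exists t0; first exact: t00.
move=> t tt0.
have {}pG s : 0 < s <= t0 -> positive (G s - (e%:C)%:M).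
  by move=> /andP[/ltW s0 st]; apply: pG; rewrite s0 st.
split; first exact: pG.
have kk : selfadjoint (k *m k) by rewrite /selfadjoint adj_mulmx (hk : adj k = k).
have C10 : 0 <= C1.
  apply: addr_ge0 (retr_sqr_ge0 kk); apply: mulr_ge0 (retr_sqr_ge0 hk).
  by rewrite invr_ge0 mulr_ge0 // ltW.
apply: (entropy_telescope (psi := fun s => entropy D (G s)) C10 _ _ tt0).
  (* As tr D^2 = 1, [klein] against D is the nonnegativity of the entropy. *)
  move=> s /pG ps; have := klein e0 ps positive_base.
  by rewrite D1.
move=> s r s0 /andP[sr rt]; apply: (entropy_step s0 sr); apply: pG.
  by rewrite s0 (le_trans sr).
by rewrite (lt_le_trans s0).
Qed.

End Perturbation.

End RelativeEntropy.

(** * The functional H *)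

Section LogSobolevFunctional.
Context {R : realType} {n : nat}.
Implicit Types (A B V W : operator R n) (a b : 'I_n -> R).

(** The functional calculus does not depend on the diagonalization: with X = V W*, equality says
    that [a i = b j] wherever [X i j] is nonzero, and [phi] preserves this. *)
Lemma eq_uconj_funcalc V W a b phi : V \is unitarymx -> W \is unitarymx ->
  uconj V a = uconj W b -> uconj V (phi \o a) = uconj W (phi \o b).
Proof.
move=> Vu Wu; pose X := V *m W ^t*.
have conj p q : uconj V p = uconj W q ->
    diag_mx (\row_i (p i)%:C) *m X = X *m diag_mx (\row_i (q i)%:C).
  move=> /(congr1 (fun A => V *m A *m W ^t*)); rewrite !uconjE /X !mulmxA.
  by rewrite (unitarymxP Vu) mul1mx -!mulmxA (unitarymxP Wu) mulmx1 !mulmxA.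
have unconj p q : diag_mx (\row_i (p i)%:C) *m X = X *m diag_mx (\row_i (q i)%:C) ->
    uconj V p = uconj W q.
  move=> /(congr1 (fun A => V ^t* *m A *m W)); rewrite !uconjE /X !mulmxA.
  by rewrite (unitarymxC Vu) mul1mx -!mulmxA (unitarymxC Wu) mulmx1 !mulmxA.
move=> /conj E; apply: unconj; apply/matrixP => i j.
move: E => /matrixP/(_ i j); clear conj; move: X => X.
rewrite !mul_diag_mx !mul_mx_diag !mxE mulrC => /eqP.
rewrite -subr_eq0 -mulrBr mulf_eq0 => /orP[/eqP ->|]; first by rewrite mulr0 mul0r.
by rewrite subr_eq0 => /eqP/complexI /= ->; rewrite mulrC.
Qed.

Lemma retr_mul_real A B : selfadjoint A -> selfadjoint B ->
  \tr (A *m B) = (retr (A *m B))%:C.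
Proof.
move=> hA hB; rewrite /retr RRe_real //; apply/CrealP.
by rewrite -mxtr_adj adj_mulmx (hA : adj A = A) (hB : adj B = B) mxtrace_mulC.
Qed.

Lemma retr_sqr_eq0 A : selfadjoint A -> retr (A *m A) = 0 -> A = 0.
Proof.
move=> /uconj_spectral[V [a [Vu AE _]]] A0.
have a0 i : a i = 0.
  move: A0; rewrite AE (uconjM _ _ Vu) -[uconj V _]mulmx1 -(uconj_cst 1 Vu).
  rewrite /retr trace_uconjM /= => /eqP; rewrite psumr_eq0; last first.
    move=> j _; apply: sumr_ge0 => l _; rewrite mulr1 mulr_ge0 ?overlap_ge0 //.
    by rewrite -expr2 sqr_ge0.
  move=> /allP/(_ i (mem_index_enum _))/=; rewrite psumr_eq0; last first.
    move=> l _; rewrite mulr1 mulr_ge0 ?overlap_ge0 //.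
    by rewrite -expr2 sqr_ge0.
  move=> /allP/(_ i (mem_index_enum _))/=.
  (* Both bases are V here, so the overlap of i with itself is 1 and the diagonal term is the
     squared eigenvalue. *)
  rewrite /overlap (unitarymxP Vu) !mxE eqxx /= expr1n expr0n addr0 mul1r mulr1.
  by rewrite mulf_eq0 orbb => /eqP.
by rewrite AE (_ : a = fun=> 0) ?(uconj_cst _ Vu) ?raddf0 //; apply/funext.
Qed.

Lemma mxtrace_sandwich (q x y : operator R n) :
  \tr (q *m q *m x *m (q *m q) *m y) = \tr (q *m x *m q *m (q *m y *m q)).
Proof. by rewrite -!mulmxA [LHS]mxtrace_mulC !mulmxA. Qed.

Lemma mxtrace_cyclic3 (A B C : operator R n) : \tr (A *m (B *m C)) = \tr (C *m A *m B).
Proof. by rewrite mulmxA mxtrace_mulC mulmxA. Qed.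

(** Read q, p, l as rho^(1/4), rho^(-1/4), log rho. The outer factors p cancel against q, and l
    commutes with q, so it can be moved next to g. *)
Lemma mxtrace_T2 (q p f g l L : operator R n) (c : R[i]) :
  q *m p = 1%:M -> p *m q = 1%:M -> l *m q = q *m l -> g = q *m f *m q ->
  \tr (g *m (q *m (p *m (g *m L) *m p - c *: (f *m l + l *m f)) *m q)) =
  \tr (g *m g *m L) - c * 2 * \tr (g *m g *m l).
Proof.
move=> qp pq lq gE.
have -> : q *m (p *m (g *m L) *m p - c *: (f *m l + l *m f)) *m q =
    g *m L - c *: (g *m l + l *m g).
  rewrite mulmxBr mulmxBl; congr (_ - _).
    by rewrite !mulmxA qp mul1mx -!mulmxA pq mulmx1.
  rewrite -scalemxAr -scalemxAl; congr (_ *: _).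
  rewrite mulmxDr mulmxDl gE -!mulmxA lq; congr (_ + _).
  by rewrite !mulmxA lq.
rewrite mulmxBr -scalemxAr mulmxDr raddfB /= mxtraceZ mxtraceD mulmxA.
rewrite [\tr (g *m (l *m g))]mxtrace_cyclic3 (mulmxA g g l).
by rewrite -mulrA mulr_natl mulr2n.
Qed.

Lemma sandwichK (q p f : operator R n) : q *m p = 1%:M -> p *m q = 1%:M ->
  p *m (q *m f *m q) *m p = f.
Proof. by move=> qp pq; rewrite !mulmxA pq mul1mx -mulmxA qp mulmx1. Qed.

Lemma selfadjoint_sandwich (q f : operator R n) :
  selfadjoint q -> selfadjoint f -> selfadjoint (q *m f *m q).
Proof. by rewrite /selfadjoint !adj_mulmx => -> ->; rewrite mulmxA. Qed.

(** * Powers of the density and the expansion of H at the identity *)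

Section Density.
Variables (rho : operator R n) (e : R).
Hypotheses (e0 : 0 < e) (rho_ge : positive (rho - (e%:C)%:M)).

Lemma mxpow_selfadjoint (a : R) : selfadjoint (mxpow rho a).
Proof.
have [V [r [_ _ _ ph]]] := spectral_lower_bound rho_ge.
by rewrite /mxpow ph; exact: adj_uconj.
Qed.

Lemma mxpowD (a b : R) : mxpow rho a *m mxpow rho b = mxpow rho (a + b).
Proof.
have [V [r [Vu _ re ph]]] := spectral_lower_bound rho_ge.
rewrite /mxpow !ph (uconjM _ _ Vu); congr uconj; apply/funext => i /=.
by rewrite powRD //; apply/implyP => _; rewrite gt_eqF // (lt_le_trans e0).
Qed.

Lemma mxpow1 : mxpow rho 1 = rho.
Proof.
have [V [r [Vu rE re ph]]] := spectral_lower_bound rho_ge.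
rewrite /mxpow ph [RHS]rE; congr uconj; apply/funext => i /=.
by rewrite powRr1 // (le_trans (ltW e0)).
Qed.

Lemma mxpow0 : mxpow rho 0 = 1%:M.
Proof.
have [V [r [Vu rE re ph]]] := spectral_lower_bound rho_ge.
rewrite /mxpow ph -[1%:M](uconj_cst 1 Vu); congr uconj; apply/funext => i /=.
by rewrite powRr0.
Qed.

Lemma mxpowV (a : R) : mxpow rho a *m mxpow rho (- a) = 1%:M.
Proof. by rewrite mxpowD subrr mxpow0. Qed.

Lemma mxpowVl (a : R) : mxpow rho (- a) *m mxpow rho a = 1%:M.
Proof. by rewrite mxpowD addNr mxpow0. Qed.

Lemma mxpow_mxlog_comm (a : R) : mxpow rho a *m mxlog rho = mxlog rho *m mxpow rho a.
Proof.
have [V [r [Vu rE re ph]]] := spectral_lower_bound rho_ge.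
rewrite /mxpow /mxlog !ph !(uconjM _ _ Vu); congr uconj; apply/funext => i /=.
by rewrite mulrC.
Qed.

(** The spectral theorem may choose another eigenbasis for the power than for [rho];
    [eq_uconj_funcalc] reconciles the two. *)
Lemma mxlog_mxpow (a : R) : mxlog (mxpow rho a) = a%:C *: mxlog rho.
Proof.
have [V [r [Vu rE re ph]]] := spectral_lower_bound rho_ge.
have [W [b [Wu bE phb]]] := uconj_spectral (mxpow_selfadjoint a).
rewrite /mxlog phb ph uconjZ; symmetry.
have -> : (fun i => a * ((@ln R) \o r) i) = @ln R \o ((fun x => x `^ a) \o r).
  by apply/funext => i /=; rewrite ln_powR.
by apply: eq_uconj_funcalc => //; rewrite -bE -ph.
Qed.

Lemma mxpow_ge (a : R) : 0 <= a -> positive (mxpow rho a - ((e `^ a)%:C)%:M).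
Proof.
move=> a0; have [V [r [Vu rE re ph]]] := spectral_lower_bound rho_ge.
rewrite /mxpow ph (uconjB_cst _ _ Vu); apply/(positive_uconj _ Vu) => i /=.
by rewrite subr_ge0 ge0_ler_powR // nnegrE ltW // (lt_le_trans e0).
Qed.

Let D := mxpow rho 2^-1.
Let q := mxpow rho 4^-1.

Lemma mxpow_quarter_sqr : q *m q = D.
Proof. by rewrite /q mxpowD; congr mxpow; lra. Qed.

Lemma mxpow_half_sqr : D *m D = rho.
Proof. by rewrite /D mxpowD -[RHS]mxpow1; congr mxpow; lra. Qed.

(** The embedding of f as rho^(1/4) f rho^(1/4) turns this scalar product into the Hilbert-Schmidt
    one. *)
Lemma ipE f g : ip rho f g = \tr (q *m adj f *m q *m (q *m g *m q)).
Proof. by rewrite /ip -/D -mxpow_quarter_sqr mxtrace_sandwich. Qed.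

Lemma ip_T2 f : selfadjoint f -> let g := q *m f *m q in
  ip rho f (T2 rho f) = \tr (g *m g *m mxlog g) - \tr (g *m g *m mxlog D).
Proof.
move=> hf g; rewrite ipE (hf : adj f = f) /T2 -/q -/g.
have qp := mxpowV 4^-1; have pq := mxpowVl 4^-1.
rewrite (mxtrace_T2 _ _ qp pq (esym (mxpow_mxlog_comm _)) erefl); congr (_ - _).
(* The coefficient 1/4 occurs twice, and half of log rho is log D. *)
rewrite mxlog_mxpow -scalemxAr mxtraceZ; congr (_ * _).
have -> : 2 = (2 : R)%:C :> R[i] by rewrite rmorphMn.
by rewrite -rmorphM; congr _%:C; lra.
Qed.

Let hq : selfadjoint q := mxpow_selfadjoint _.

Lemma H_real (f : operator R n) (d : R) : selfadjoint f -> 0 < d ->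
  positive (q *m f *m q - (d%:C)%:M) -> 0 < retr (q *m f *m q *m (q *m f *m q)) ->
  let g := q *m f *m q in
  H rho f = (retr (g *m g *m mxlog g) - retr (g *m g *m mxlog D)
             - retr (g *m g) * ln (retr (g *m g)) / 2)%:C.
Proof.
move=> hf d0 gd m0 /=; rewrite /H (ip_T2 hf) /norm2 ipE (hf : adj f = f).
have D_ge : positive (D - ((e `^ 2^-1)%:C)%:M) by apply: mxpow_ge; rewrite invr_ge0.
have hD := selfadjoint_mxlog D_ge.
move: (q *m f *m q) (selfadjoint_sandwich hq hf) gd m0 => g hg gd m0.
move: (mxlog D) hD (mxlog g) (selfadjoint_mxlog gd) => lD hD lg hlg.
have hgg : selfadjoint (g *m g) by rewrite /selfadjoint adj_mulmx (hg : adj g = g).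
rewrite (retr_mul_real hgg hlg) (retr_mul_real hgg hD) -/(retr (g *m g)).
by rewrite sqr_sqrtr ?ln_sqrt ?(ltW m0) // mulrA !rmorphB.
Qed.

Lemma ip_selfadjoint_ge0 (g : operator R n) : selfadjoint g ->
  0 <= complex.Re (ip rho g g) /\ ip rho g g = (complex.Re (ip rho g g))%:C.
Proof.
move=> hg; rewrite ipE (hg : adj g = g).
move: (q *m g *m q) (selfadjoint_sandwich hq hg) => k hk.
by split; [exact: retr_sqr_ge0|exact: retr_mul_real].
Qed.

Lemma ip_selfadjoint_eq0 (g : operator R n) : selfadjoint g ->
  complex.Re (ip rho g g) <= 0 -> g = 0.
Proof.
move=> hg; rewrite ipE (hg : adj g = g).
have hk := selfadjoint_sandwich hq hg => k0.
have qgq : q *m g *m q = 0.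
  apply: (retr_sqr_eq0 hk); apply/eqP; rewrite eq_le (retr_sqr_ge0 hk) andbT; exact: k0.
have qp := mxpowV 4^-1; have pq := mxpowVl 4^-1.
have -> : g = mxpow rho (- 4^-1) *m (q *m g *m q) *m mxpow rho (- 4^-1).
  by rewrite sandwichK.
by rewrite qgq mulmx0 mul0mx.
Qed.

Hypothesis rho1 : \tr rho = 1.

Lemma H_lower_bound (g : operator R n) : selfadjoint g -> \tr (rho *m g) = 0 ->
  exists (t0 C : R), 0 < t0 /\ forall t, 0 < t <= t0 ->
    strictly_positive (1%:M + t%:C *: g) /\
    exists2 h, H rho (1%:M + t%:C *: g) = h%:C &
      t * t * complex.Re (ip rho g g) - t * t * t * C <= h.
Proof.
move=> hg g0; pose k := q *m g *m q.
have hk : selfadjoint k := selfadjoint_sandwich hq hg.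
(* [e ^ (1/2)] bounds D from below; half of it is the margin left for the perturbed matrix. *)
pose d := (e `^ 2^-1) / 2.
have d0 : 0 < d by rewrite divr_gt0 // powR_gt0.
have D_ge : positive (D - ((2 * d)%:C)%:M).
  have -> : 2 * d = e `^ 2^-1 by rewrite /d mulrC divfK.
  by apply: mxpow_ge; rewrite invr_ge0.
have D1 : retr (D *m D) = 1 by rewrite mxpow_half_sqr /retr rho1.
have Dk0 : retr (D *m k) = 0.
  rewrite /k -mxpow_quarter_sqr retrC.
  have -> : q *m g *m q *m (q *m q) = q *m (g *m (q *m q *m q)) by rewrite !mulmxA.
  rewrite retrC -mulmxA retrC.
  have -> : q *m q *m q *m q = rho.
    by rewrite -mulmxA mxpow_quarter_sqr mxpow_half_sqr.
  by rewrite /retr g0.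
(* The perturbation lemma is used a second time, around the identity with margin 1/2, for the strict
   positivity of [1 + t g] itself. *)
have I_ge : positive (1%:M - ((2 * 2^-1)%:C)%:M : operator R n).
  have two0 : (2 : R) != 0 by [].
  rewrite (divff two0) rmorph1 subrr; have := @positive_scalar R n 0 (lexx 0).
  rewrite (_ : _%:M = 0 :> operator R n); first exact: id.
  by apply/matrixP => i j; rewrite !mxE mul0rn.
have half0 : 0 < 2^-1 :> R by rewrite invr_gt0.
have [t1 t10 I_pos] := positive_perturbation half0 I_ge hg.
have [t2 t20 ent] := entropy_lower_bound d0 D_ge hk D1.
move: ent; set K := retr (k *m k); set C1 := _ * K + _ => ent.
(* The bound 1 serves [entropy_bound_arith], [t1] strict positivity and [t2] the entropy
   estimate. *)
exists (Num.min 1 (Num.min t1 t2)), ((C1 + K * K) / 2).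
split; first by rewrite !lt_min ltr01 t10 t20.
move=> t; rewrite !le_min => /andP[tp /and3P[tle1 tlet1 tlet2]].
split.
  exists 2^-1; first exact: half0.
  by apply: I_pos; rewrite (ltW tp) tlet1.
have KE : complex.Re (ip rho g g) = K by rewrite ipE (hg : adj g = g).
have GE : q *m (1%:M + t%:C *: g) *m q = D + t%:C *: k.
  rewrite mulmxDr mulmxDl mulmx1 mxpow_quarter_sqr.
  by rewrite -scalemxAr -scalemxAl.
have hf : selfadjoint (1%:M + t%:C *: g).
  apply: selfadjointD (selfadjointZ _ hg).
  by rewrite /selfadjoint adj_scalar rmorph1.
have mE : retr ((D + t%:C *: k) *m (D + t%:C *: k)) = 1 + t * t * K.
  exact: retr_base_sqr_perturbation.
have K0 : 0 <= K := retr_sqr_ge0 hk.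
have ttK : 0 <= t * t * K by rewrite !mulr_ge0 // ltW.
have m0 : 0 < 1 + t * t * K by rewrite ltr_pwDl.
have tt2 : 0 < t <= t2 by rewrite tp.
have [Gd] := ent t tt2; rewrite /entropy mE => entE.
eexists; first by apply: (H_real hf d0); rewrite GE ?mE.
rewrite KE GE mE.
exact: entropy_bound_arith tp tle1 K0 entE.
Qed.

End Density.

End LogSobolevFunctional.

(** * Semigroup and generator *)

Section Limits.
Context {R : realType} {n : nat} {T : Type} (F : set_system T) {FF : ProperFilter F}.
Implicit Types (f g : T -> top_operator R n) (L B : operator R n).

Lemma cvg_trace f L B : f @ F --> (L : top_operator R n) ->
  (fun t => \tr (B *m (f t : operator R n)) : (R[i])^o) @ F --> (\tr (B *m L) : (R[i])^o).
Proof.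
move=> fL.
have fc i j : (fun t => f t i j) @ F --> (L i j : (R[i])^o).
  exact: (cvg_comp _ _ fL (@coord_continuous (R[i])^o n n i j L)).
have -> : (fun t => \tr (B *m (f t : operator R n)) : (R[i])^o) =
    (fun t => \sum_i \sum_j (B i j : (R[i])^o) * f t j i).
  by apply/funext => t; apply: eq_bigr => i _; rewrite mxE.
have -> : \tr (B *m L) = \sum_i \sum_j (B i j : (R[i])^o) * L j i.
  by apply: eq_bigr => i _; rewrite mxE.
apply: cvg_big => [|i _]; first exact: add_continuous.
apply: cvg_big => [|j _]; first exact: add_continuous.
by apply: cvgM; [exact: cvg_cst|exact: fc].
Qed.

Lemma lim_unique f L : f @ F --> (L : top_operator R n) -> lim (f @ F) = L.
Proof. by move=> fL; apply: cvg_lim. Qed.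

Lemma cvg_scale f L (c : R[i]) : f @ F --> (L : top_operator R n) ->
  (fun t => c *: (f t : operator R n) : top_operator R n) @ F --> (c *: L : top_operator R n).
Proof. by move=> fL; apply: cvgZl_tmp. Qed.

(* The default value of [lim] is the zero matrix. *)
Lemma dvg_lim f : ~ (cvg (f @ F)) -> lim (f @ F) = 0.
Proof. by move=> /dvgP ->; apply/matrixP => i j; rewrite !mxE. Qed.

End Limits.

(** Divide by [t^2] and let t tend to 0. *)
Lemma le_of_cubic_error {R : realType} (K C x t0 : R) : 0 < t0 ->
  (forall t, 0 < t <= t0 -> t * t * K - t * t * t * C <= t * t * x) -> K <= x.
Proof.
move=> t00 h; apply/ler_addgt0Pr => eps eps0.
pose t := Num.min t0 (eps / (`|C| + 1)).
have C1 : 0 < `|C| + 1 by rewrite ltr_wpDl.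
have tp : 0 < t by rewrite lt_min t00 divr_gt0.
have tle : t <= t0 by rewrite ge_min lexx.
have tC : t * (`|C| + 1) <= eps by rewrite -ler_pdivlMr // ge_min lexx orbT.
have Cn : t * C <= t * `|C| by rewrite ler_pM2l // ler_norm.
have : t * t * (K - t * C) <= t * t * x.
  by apply: le_trans (h t _); [rewrite le_eqVlt; apply/orP; left; apply/eqP; ring|rewrite tp].
rewrite ler_pM2l ?mulr_gt0 // => h1.
lra.
Qed.

Section SemigroupTheory.
Context {R : realType} {n : nat}.
Variables (M : set (operator R n)) (P : R -> operator R n -> operator R n).
Hypotheses (hM : von_neumann_algebra M) (hP : positive_semigroup M P).
Implicit Types (f g L : operator R n) (z : R[i]).

Lemma vna_adj f : M f -> M (adj f).
Proof. exact: hM.1. Qed.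

(** The algebraic structure of M is read off from its being a bicommutant. *)
Lemma vna_scalar z : M z%:M.
Proof. by rewrite -hM.2 => B _; rewrite scalar_mxC. Qed.

Lemma vnaD f g : M f -> M g -> M (f + g).
Proof.
rewrite -hM.2 => Mf Mg B MB.
by rewrite mulmxDl mulmxDr (Mf B MB) (Mg B MB).
Qed.

Lemma vnaZ z f : M f -> M (z *: f).
Proof. by rewrite -hM.2 => Mf B MB; rewrite -scalemxAl (Mf B MB) scalemxAr. Qed.

Definition difference_quotient f (t : R) : top_operator R n :=
  (t^-1)%:C *: (P t f - f).

Lemma semigroup0 (t : R) : 0 <= t -> P t 0 = 0.
Proof.
move=> t0; have M0 : M 0 by rewrite -[0](scale0r 1%:M); exact/vnaZ/vna_scalar.
have := psg_linear hP 1 t0 M0 M0; rewrite !scale1r addr0.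
by move=> /(congr1 (fun x => x - P t 0)); rewrite subrr addrK.
Qed.

Lemma semigroup_scalar z (t : R) : 0 <= t -> P t z%:M = z%:M.
Proof.
move=> t0; have M0 : M 0 by rewrite -[0](scale0r 1%:M); exact/vnaZ/vna_scalar.
have := psg_linear hP z t0 (vna_scalar 1) M0.
by rewrite (psg_unital hP t0) (semigroup0 t0) !addr0 scalemx1.
Qed.

Lemma semigroupD f g (t : R) : 0 <= t -> M f -> M g -> P t (f + g) = P t f + P t g.
Proof. by move=> t0 Mf Mg; have := psg_linear hP 1 t0 Mf Mg; rewrite !scale1r. Qed.

(** A multiple of the identity added to f makes it positive; positivity is preserved, implies
    self-adjointness, and the multiple is fixed by [P t]. *)
Lemma semigroup_selfadjoint f (t : R) : 0 <= t -> M f -> selfadjoint f ->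
  selfadjoint (P t f).
Proof.
move=> t0 Mf hf; have [c _ /(_ 1 ler01)] := selfadjoint_lower_bound hf.
rewrite scale1r mul1r => pf.
have := psg_positive hP t0 (vnaD Mf (vna_scalar c%:C)) pf.
rewrite semigroupD ?semigroup_scalar //; last exact: vna_scalar.
move=> /positive_selfadjoint h; rewrite -(addrK (c%:C)%:M (P t f)).
exact: selfadjointB h (selfadjoint_scalar _).
Qed.

(** The semigroup laws hold for nonnegative times only, so difference quotients can be compared only
    to the right of 0. *)
Lemma eq_right_cvg {T : topologicalType} (F G : R -> T) (l : T) :
  (forall t : R, 0 < t -> F t = G t) -> F @ 0^'+ --> l -> G @ 0^'+ --> l.
Proof.
move=> FG; apply: cvg_trans; apply: near_eq_cvg.
near=> t; apply: FG; near: t; exact: nbhs_right_gt.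
Unshelve. all: by end_near. Qed.

Lemma difference_quotient_linear z f g L L' : M f -> M g ->
  difference_quotient f @ 0^'+ --> (L : top_operator R n) ->
  difference_quotient g @ 0^'+ --> (L' : top_operator R n) ->
  difference_quotient (z *: f + g) @ 0^'+ --> (z *: L + L' : top_operator R n).
Proof.
move=> Mf Mg fL gL.
have h := cvgD (cvg_scale (c := z) fL) gL.
refine (eq_right_cvg _ (h _ _)) => t t0.
rewrite -[LHS]/(z *: ((t^-1)%:C *: (P t f - f)) + (t^-1)%:C *: (P t g - g) : operator R n).
rewrite /difference_quotient (psg_linear hP z (ltW t0) Mf Mg).
rewrite scalerA mulrC -scalerA -scalerDr; congr (_ *: _).
by rewrite scalerBr opprD !addrA; congr (_ + _); rewrite addrAC.
Qed.

Lemma difference_quotient_scalar z :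
  difference_quotient z%:M @ 0^'+ --> (0 : top_operator R n).
Proof.
refine (eq_right_cvg _ (cvg_cst (0 : top_operator R n))) => t t0.
by rewrite /difference_quotient (semigroup_scalar _ (ltW t0)) subrr scaler0.
Qed.

Lemma generatorE f L : difference_quotient f @ 0^'+ --> (L : top_operator R n) ->
  generator P f = L.
Proof. exact: lim_unique. Qed.

Lemma generator_dvg f : ~ cvg (difference_quotient f @ 0^'+) -> generator P f = 0.
Proof. exact: dvg_lim. Qed.

(** * The generator and the scalar product *)

Variables (rho : operator R n) (e : R).
Hypotheses (e0 : 0 < e) (rho_ge : positive (rho - (e%:C)%:M)).
Hypotheses (hrho : faithful_invariant_density M P rho).
Hypotheses (hsym : symmetric_semigroup M P rho).

Lemma ipDr f g g' : ip rho f (g + g') = ip rho f g + ip rho f g'.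
Proof. by rewrite /ip mulmxDr mxtraceD. Qed.

Lemma ipBr f g g' : ip rho f (g - g') = ip rho f g - ip rho f g'.
Proof. by rewrite /ip mulmxBr raddfB. Qed.

Lemma ipZr z f g : ip rho f (z *: g) = z * ip rho f g.
Proof. by rewrite /ip -scalemxAr mxtraceZ. Qed.

Lemma ipDl f f' g : ip rho (f + f') g = ip rho f g + ip rho f' g.
Proof. by rewrite /ip adj_add mulmxDr !mulmxDl mxtraceD. Qed.

Lemma ipZl z f g : ip rho (z *: f) g = z^*%R * ip rho f g.
Proof. by rewrite /ip adj_scale -scalemxAr -!scalemxAl mxtraceZ. Qed.

Lemma ip0r f : ip rho f 0 = 0.
Proof. by rewrite /ip mulmx0 mxtrace0. Qed.

Lemma ip_selfadjointC f g : selfadjoint f -> selfadjoint g ->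
  ip rho f g = ip rho g f.
Proof.
rewrite /ip => -> ->; move: (mxpow rho _) => D.
by rewrite -(mulmxA (D *m f)) mxtrace_mulC mulmxA.
Qed.

Lemma ip1l f : ip rho 1%:M f = \tr (rho *m f).
Proof.
rewrite /ip adj_scalar rmorph1; have := mxpow_half_sqr e0 rho_ge.
by move: (mxpow rho _) => D DE; rewrite mulmx1 DE.
Qed.

Lemma cvg_ip f g L : difference_quotient g @ 0^'+ --> (L : top_operator R n) ->
  (fun t => ip rho f (difference_quotient g t) : (R[i])^o) @ 0^'+ -->
    (ip rho f L : (R[i])^o).
Proof. exact: cvg_trace. Qed.

(** Invariance of [rho] makes every difference quotient orthogonal to the identity. *)
Lemma ip1_generator g L : M g ->
  difference_quotient g @ 0^'+ --> (L : top_operator R n) -> ip rho 1%:M L = 0.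
Proof.
move=> Mg gL; have := cvg_ip (f := 1%:M) gL => h.
have h0 : (fun t => ip rho 1%:M (difference_quotient g t) : (R[i])^o) @ 0^'+ -->
    (0 : (R[i])^o).
  refine (eq_right_cvg _ (cvg_cst (0 : (R[i])^o))) => t t0.
  rewrite ip1l -scalemxAr mxtraceZ mulmxBr raddfB /=.
  by rewrite (fid_invariant hrho (ltW t0) Mg) subrr mulr0.
exact: (cvg_unique _ h h0).
Qed.

(** Symmetry of [P t] passes to the limit. On self-adjoint elements the arguments of [ip] may be
    exchanged, which keeps the quotient in the second slot, where [cvg_ip] applies. *)
Lemma ip_generatorC f g L L' : M f -> M g -> selfadjoint f -> selfadjoint g ->
  difference_quotient f @ 0^'+ --> (L : top_operator R n) ->
  difference_quotient g @ 0^'+ --> (L' : top_operator R n) ->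
  ip rho f L' = ip rho g L.
Proof.
move=> Mf Mg hf hg fL gL.
have h : (fun t => ip rho f (difference_quotient g t) : (R[i])^o) @ 0^'+ -->
    (ip rho g L : (R[i])^o).
  refine (eq_right_cvg _ (cvg_ip (f := g) fL)) => t t0.
  rewrite /difference_quotient !ipZr !ipBr.
  rewrite (ip_selfadjointC hf hg) -(hsym (ltW t0) Mf Mg).
  by rewrite (ip_selfadjointC (semigroup_selfadjoint (ltW t0) Mf hf) hg).
exact: (cvg_unique _ (cvg_ip (f := f) gL) h).
Qed.

Lemma unperturb z g : z != 0 ->
  g = z^-1 *: (1%:M + z *: g) + (- z^-1)%:M.
Proof.
move=> z0; rewrite -[X in _ + X]scalemx1 scaleNr scalerDr scalerA (mulVf z0) scale1r.
by rewrite addrAC subrr add0r.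
Qed.

Lemma scalar_mx_is_zero : 0%:M = 0 :> operator R n.
Proof. by apply/matrixP => i j; rewrite !mxE mul0rn. Qed.

(** Since g is a combination of [1 + z g] and a scalar, divergence at g forces divergence at
    [1 + z g]. *)
Lemma cvg_unperturb z g : M g -> z != 0 ->
  cvg (difference_quotient (1%:M + z *: g) @ 0^'+) ->
  cvg (difference_quotient g @ 0^'+).
Proof.
move=> Mg z0 cf; rewrite (unperturb g z0).
have Mf : M (1%:M + z *: g) by apply: vnaD; [exact: vna_scalar|exact: vnaZ].
exact: cvgP (difference_quotient_linear (z := z^-1) Mf (vna_scalar _) cf
  (difference_quotient_scalar (- z^-1))).
Qed.

(** Convergence belongs to the conclusion because recombining real and imaginary parts requires
    linearity of the generator. *)
Lemma gap_selfadjoint (c : R) g : 0 < c -> log_sobolev M P rho c ->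
  M g -> selfadjoint g -> \tr (rho *m g) = 0 ->
  difference_quotient g @ 0^'+ --> (generator P g : top_operator R n) /\
  (c^-1 * complex.Re (ip rho g g))%:C <= dirichlet P rho g g.
Proof.
move=> c0 LSI Mg hg trg.
have [t0 [C [t00 HH]]] := H_lower_bound e0 rho_ge (fid_tr hrho) hg trg.
have M1 := vna_scalar 1.
have Mf (t : R) : M (1%:M + t%:C *: g) by apply: vnaD => //; exact: vnaZ.
have tn0 (t : R) : 0 < t -> t%:C != 0 :> R[i].
  by move=> t1; rewrite (inj_eq (@complexI R) t 0) gt_eqF.
have [cg|ncg] := pselect (cvg (difference_quotient g @ 0^'+)); last first.
  have gen0 (t : R) : 0 < t -> generator P (1%:M + t%:C *: g) = 0.
    move=> /tn0 tn; apply: generator_dvg => cf.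
    exact: ncg (cvg_unperturb Mg tn cf).
  (* The quotient of 0 converges, so [g = 0] would contradict divergence. With a vanishing generator
     the inequality gives H <= 0 along [1 + t g], hence <g, g> <= 0 and [g = 0]. *)
  exfalso; apply: ncg.
  suff -> : g = 0.
    have h := difference_quotient_scalar 0; rewrite scalar_mx_is_zero in h.
    exact: cvgP h.
  apply: (ip_selfadjoint_eq0 e0 rho_ge hg).
  apply: (le_of_cubic_error (C := C) t00) => t tt0.
  have [pf [h HE hK]] := HH t tt0.
  apply: le_trans hK _; rewrite mulr0.
  have := LSI _ (Mf t) pf; rewrite HE /dirichlet gen0 ?ip0r ?oppr0 ?mulr0; last by case/andP: tt0.
  by rewrite (_ : 0 = (0 : R)%:C) // lecR.
split; first exact: cg.
set L := generator P g.
have L1 : ip rho 1%:M L = 0 := ip1_generator Mg cg.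
(* The generator kills the identity and its range is orthogonal to it, so only the term of order
   [t^2] survives. *)
have dE (t : R) : dirichlet P rho (1%:M + t%:C *: g) (1%:M + t%:C *: g) =
    (t * t)%:C * dirichlet P rho g g.
  rewrite /dirichlet; have -> : generator P (1%:M + t%:C *: g) = t%:C *: L.
    rewrite addrC; apply: generatorE; rewrite -[_ *: L]addr0.
    exact: (difference_quotient_linear Mg M1 cg (difference_quotient_scalar _)).
  rewrite ipZr ipDl ipZl L1 add0r conjC_real rmorphM mulrN.
  by rewrite mulrA.
move: dE; case: (dirichlet P rho g g) => d1 d2 dE.
have key (t : R) : 0 < t <= t0 ->
    t * t * d2 = 0 /\ t * t * complex.Re (ip rho g g) - t * t * t * C <= t * t * (c * d1).
  move=> tt0; have [pf [h HE hK]] := HH t tt0.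
  have := LSI _ (Mf t) pf; rewrite HE dE lecE /=.
  rewrite !mul0r !subr0 !addr0 => /andP[/eqP h1 h2]; split.
    by move: h1 => /eqP; rewrite mulf_eq0 gt_eqF //= => /eqP.
  by apply: (le_trans hK); rewrite mulrCA.
(* H is real at [1 + t g], and the order of [R[i]] equates imaginary parts. *)
have d20 : d2 = 0.
  have [] := key t0; first by rewrite t00 lexx.
  by move=> /eqP; rewrite !mulf_eq0 gt_eqF //= => /eqP.
rewrite d20 lecE /= eqxx /= mulrC ler_pdivrMr // mulrC.
apply: (le_of_cubic_error (C := C) t00) => t tt0; exact: (key t tt0).2.
Qed.

End SemigroupTheory.

(** * From self-adjoint to general elements *)

Section Decomposition.
Context {R : realType} {n : nat}.
Implicit Types (f g : operator R n) (z : R[i]).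

Lemma mulii : 'i * 'i = -1 :> R[i].
Proof. by rewrite -expr2 sqr_i. Qed.

Lemma cartesian_decomposition f :
  let a := 2^-1 *: (f + adj f) in let b := (- 'i / 2) *: (f - adj f) in
  [/\ selfadjoint a, selfadjoint b & f = a + 'i *: b].
Proof.
have half : (2^-1 : R[i])^*%R = 2^-1 by rewrite fmorphV rmorph_nat.
split.
- by rewrite /selfadjoint adj_scale half adj_add adj_adj addrC.
- rewrite /selfadjoint adj_scale rmorphM /= half rmorphN /= conjC_i opprK.
  by rewrite adj_add adj_opp adj_adj -(opprB f) scalerN -scaleNr mulNr.
rewrite scalerA mulrA mulrN mulii opprK mul1r -scalerDr addrACA subrr addr0.
have -> : f + f = (2 : R[i]) *: f by rewrite scaler_nat mulr2n.
by rewrite scalerA mulVf ?scale1r ?pnatr_eq0.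
Qed.

End Decomposition.

Section SpectralGap.
Context {R : realType} {n : nat}.
Variables (M : set (operator R n)) (P : R -> operator R n -> operator R n).
Variables (rho : operator R n) (e : R).
Hypotheses (hM : von_neumann_algebra M) (hP : positive_semigroup M P).
Hypotheses (e0 : 0 < e) (rho_ge : positive (rho - (e%:C)%:M)).
Hypotheses (hrho : faithful_invariant_density M P rho).
Hypotheses (hsym : symmetric_semigroup M P rho).
Variables (a b : operator R n) (m : R[i]).
Hypotheses (Ma : M a) (Mb : M b) (ha : selfadjoint a) (hb : selfadjoint b).

(** The cross terms i<a, b> and -i<b, a> cancel, [ip] being symmetric on self-adjoint elements. *)
Lemma ip_cartesian : ip rho (a + 'i *: b) (a + 'i *: b) = ip rho a a + ip rho b b.
Proof.
rewrite !ipDr !ipDl !ipZr !ipZl conjC_i (ip_selfadjointC rho hb ha).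
have ii := @mulii R.
move: (ip rho a a) (ip rho a b) (ip rho b b) => x y z.
ring: ii.
Qed.

(** The cross terms cancel by [ip_generatorC]; the scalar m drops out on the right because its
    generator is 0, on the left by [ip1_generator]. *)
Lemma dirichlet_cartesian :
  difference_quotient P a @ 0^'+ --> (generator P a : top_operator R n) ->
  difference_quotient P b @ 0^'+ --> (generator P b : top_operator R n) ->
  dirichlet P rho (a + 'i *: b + m%:M) (a + 'i *: b + m%:M) =
  dirichlet P rho a a + dirichlet P rho b b.
Proof.
move=> ca cb; have Mm := vna_scalar hM m.
(* The sum is built in two steps of the form [z *: f + g], which is why a carries the factor 1. *)
have cam := difference_quotient_linear hP (z := 1) Ma Mm ca
  (difference_quotient_scalar hM hP m).
have Mam : M (1 *: a + m%:M) by apply: (vnaD hM _ Mm); exact: vnaZ.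
have LE : generator P (a + 'i *: b + m%:M) =
    'i *: generator P b + generator P a :> operator R n.
  have := generatorE (difference_quotient_linear hP (z := 'i) Mb Mam cb cam).
  by rewrite !scale1r addr0 addrA (addrC _ a).
have := ip1_generator e0 rho_ge hrho Ma ca.
have := ip1_generator e0 rho_ge hrho Mb cb.
have := ip_generatorC hM hP hsym Ma Mb ha hb ca cb.
rewrite /dirichlet LE -[m%:M]scalemx1.
move: (generator P a : operator R n) (generator P b : operator R n) => La Lb Lab Lb1 La1.
rewrite !ipDr !ipDl !ipZr !ipZl La1 Lb1 conjC_i Lab.
have ii := @mulii R.
move: (ip rho a La) (ip rho b La) (ip rho b Lb) => x y z.
ring: ii.
Qed.

End SpectralGap.

Theorem theorem11 (R : realType) (n : nat) (M : set (operator R n))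
  (P : R -> operator R n -> operator R n) (rho : operator R n) (c : R)
  (hM : von_neumann_algebra M)
  (hP : positive_semigroup M P)
  (hrho : faithful_invariant_density M P rho)
  (hsym : symmetric_semigroup M P rho)
  (hc : 0 < c)
  (hLSI : log_sobolev M P rho c) :
  spectral_gap M P rho c^-1.
Proof.
move=> f Mf; have [e e0 rho_ge] := fid_strictly_positive hrho.
(* Centring comes first, so that the real and imaginary parts of [f0] both have mean zero, as
   [gap_selfadjoint] requires. *)
set m := \tr (rho *m f); set f0 := f - m%:M.
have hr : selfadjoint rho.
  by have := mxpow_selfadjoint rho_ge 1; rewrite (mxpow1 e0 rho_ge).
have Mf0 : M f0.
  by apply: (vnaD hM Mf); rewrite -scaleN1r; apply: (vnaZ hM); exact: vna_scalar.
have tr0 : \tr (rho *m f0) = 0.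
  rewrite mulmxBr raddfB /= -/m mul_mx_scalar mxtraceZ (fid_tr hrho).
  by rewrite mulr1 subrr.
have tr0' : \tr (rho *m adj f0) = 0.
  have -> : rho *m adj f0 = adj (f0 *m rho) by rewrite adj_mulmx (hr : adj rho = rho).
  by rewrite mxtr_adj mxtrace_mulC tr0 rmorph0.
have [] := cartesian_decomposition f0.
set a := 2^-1 *: _; set b := (- 'i / 2) *: _ => ha hb f0E.
have Ma : M a by apply: (vnaZ hM); apply: (vnaD hM Mf0); exact: vna_adj.
have Mb : M b.
  apply: (vnaZ hM); apply: (vnaD hM Mf0); rewrite -scaleN1r; apply: (vnaZ hM).
  exact: vna_adj.
have tra : \tr (rho *m a) = 0.
  by rewrite /a -scalemxAr mxtraceZ mulmxDr mxtraceD tr0 tr0' addr0 mulr0.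
have trb : \tr (rho *m b) = 0.
  by rewrite /b -scalemxAr mxtraceZ mulmxBr raddfB /= tr0 tr0' subr0 mulr0.
have [ca gapa] := gap_selfadjoint hM hP e0 rho_ge hrho hc hLSI Ma ha tra.
have [cb gapb] := gap_selfadjoint hM hP e0 rho_ge hrho hc hLSI Mb hb trb.
have [a0 aE] := ip_selfadjoint_ge0 e0 rho_ge ha.
have [b0 bE] := ip_selfadjoint_ge0 e0 rho_ge hb.
have VE : Var rho f = complex.Re (ip rho a a) + complex.Re (ip rho b b).
  rewrite /Var /norm2 -/m -/f0 f0E (ip_cartesian rho ha hb) aE bE -rmorphD.
  exact: sqr_sqrtr (addr_ge0 a0 b0).
have fE : f = a + 'i *: b + m%:M by rewrite -f0E subrK.
rewrite [in leRHS]fE (dirichlet_cartesian hM hP e0 rho_ge hrho hsym m Ma Mb ha hb ca cb).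
rewrite VE mulrDr rmorphD; exact: lerD gapa gapb.
Qed.
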